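(* Let $q\ge 3$ be an integer and $\lambda>0$. There exists $\beta_0<\infty$ such that for every finite $\beta\ge\beta_0$, the Gibbs measure with states $[q+1]$ and parameters $\lambda,\beta$ does not have uniqueness on the infinite graph $G$ (the model, uniqueness and the graph $G=G_q$ are defined in the context).
   Context: The model. Write $[q+1]=\{1,\dots,q+1\}$. For parameters $\lambda,\beta>0$ and a finite graph $H=(V,E)$, the Gibbs measure is the probability distribution on $[q+1]^V$ given by $$P(\sigma)=\frac1Z\exp\Big[\lambda\sum_{u\in V}1_{\{\sigma_u=q+1\}}-\beta\sum_{(u,v)\in E}\eta(\sigma_u,\sigma_v)\Big],$$ where $Z$ is the normalizing constant and $\eta(i,j)=1$ if $1\le i=j\le q$, or if $i=q+1$ and $j\in\{1,2\}$, or if $j=q+1$ and $i\in\{1,2\}$, and $\eta(i,j)=0$ otherwise. Infinite graphs and uniqueness. Let $H=(V,E)$ be an infinite graph with finite degrees. For a finite set $A\subset V$ put $S(A,n)=\{u\in V: d(u,A)=n\}$, where $d$ is graph distance. For $\sigma^*\in[q+1]^{S(A,n)}$, $P(\sigma_A=\cdot\mid\sigma_{S(A,n)}=\sigma^* )$ denotes the law of the restriction of $\sigma$ to $A$ under the Gibbs measure $P(\sigma)=\frac1Z\exp\big[\lambda\sum_{u\in V'}1_{\{\sigma_u=q+1\}}-\beta\sum_{(u,v)\in E'}\eta(\sigma_u,\sigma_v)\big]$ on the finite subgraph $(V',E')$ induced by $V'=\{u: d(u,A)\le n\}$, conditioned on $\sigma=\sigma^*$ on $S(A,n)$ (by the Markov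 property the rest of the graph is irrelevant). The Gibbs measure has uniqueness on $H$ if for every finite $A\subset V$, $$\lim_{n\to\infty}\ \sup_{\sigma^1,\sigma^2} d_{TV}\big(P(\sigma_A=\cdot\mid\sigma_{S(A,n)}=\sigma^1),\,P(\sigma_A=\cdot\mid\sigma_{S(A,n)}=\sigma^2)\big)=0,$$ where $d_{TV}$ is total variation distance and the supremum is over all boundary conditions $\sigma^1,\sigma^2\in[q+1]^{S(A,n)}$. The graph $G$. It is built recursively in rows. Row $1$ consists of a single root vertex $v$. If $i$ is odd, then for each vertex $u$ in row $i$ add $q-1$ new vertices $u_1,\dots,u_{q-1}$ to row $i+1$, pairwise adjacent (a $(q-1)$-clique), and connect each of them to $u$, forming a $q$-clique. If $i$ is even, then for each such $(q-1)$-clique $u_1,\dots,u_{q-1}$ in row $i$ add $q-1$ new vertices $w_1,\dots,w_{q-1}$ to row $i+1$, connect $u_l$ to $w_l$ and $w_{l+1}$ for $1\le l\le q-2$, and connect $u_{q-1}$ to $w_1$ and $w_{q-1}$. There are no other vertices or edges. Every vertex of $G$ other than $v$ has degree $q+1$. *)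

(* Defs.v *)
From mathcomp Require Import all_boot all_order all_algebra.
From mathcomp Require Import finmap.
From mathcomp Require Import all_classical all_reals all_analysis.
Import Order.TTheory GRing.Theory Num.Theory.
Import numFieldNormedType.Exports.

Set Implicit Arguments.
Unset Strict Implicit.
Unset Printing Implicit Defensive.

Local Open Scope classical_set_scope.
Local Open Scope ring_scope.

(* The state i of {1, ..., q+1} is represented by the ordinal of value i - 1:
   the special state q+1 is the ordinal of value q, and the states 1 and 2
   are the ordinals of value < 2. *)
Definition spin (q : nat) : finType := 'I_q.+1.

Definition eta (q : nat) (i j : spin q) : bool :=
  [|| (i == j) && (i < q)%N, (i == q :> nat) && (j < 2)%N
    | (j == q :> nat) && (i < 2)%N].

Section Gibbs.
Variables (R : realType) (q : nat) (lambda beta : R).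
Variables (T : finType) (e : rel T).

(* Every edge occurs in the double sum with both orientations, whence the
   factor 1/2 (eta is symmetric). *)
Definition energy (s : {ffun T -> spin q}) : R :=
  lambda * (\sum_(u : T) (s u == q :> nat)%:R)
  - beta * (2^-1 * \sum_(u : T) \sum_(v : T | e u v) (eta (s u) (s v))%:R).

Definition partition_function : R :=
  \sum_(s : {ffun T -> spin q}) expR (energy s).

Definition gibbs (s : {ffun T -> spin q}) : R :=
  expR (energy s) / partition_function.

Definition gibbs_prob (E : pred {ffun T -> spin q}) : R :=
  \sum_(s | E s) gibbs s.

Definition gibbs_cond (E F : pred {ffun T -> spin q}) : R :=
  gibbs_prob (predI E F) / gibbs_prob F.

End Gibbs.

Definition dTV (R : realType) (X : finType) (mu nu : X -> R) : R :=
  2^-1 * \sum_(x : X) `|mu x - nu x|.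

Record lfgraph := LFGraph {
  vertex :> choiceType;
  adj : rel vertex;
  adj_sym : symmetric adj;
  adj_irr : irreflexive adj;
  adj_fin : forall u : vertex, finite_set [set v | adj u v] }.

Section Distance.
Variables (H : lfgraph) (A : {fset H}).

Definition walk_to (n : nat) (u : H) : Prop :=
  exists (a : H) (p : seq H),
    [/\ a \in A, path (@adj H) a p, last a p = u & size p = n].

(* dist_to u n means d(u, A) = n; no n satisfies it when d(u, A) is infinite. *)
Definition dist_to (u : H) (n : nat) : Prop :=
  walk_to n u /\ forall m : nat, (m < n)%N -> ~ walk_to m u.

Definition ball_set (n : nat) : set H :=
  [set u | exists2 m : nat, (m <= n)%N & dist_to u m].

Definition sphere_set (n : nat) : set H := [set u | dist_to u n].

Lemma walk_to_finite (n : nat) : finite_set [set u | walk_to n u].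
Proof.
elim: n => [|n IHn].
  apply: (@sub_finite_set _ _ [set` A]); last exact: finite_fset.
  by move=> u [a [p [aA _ <- /size0nil ->]]].
apply: (@sub_finite_set _ _
  (\bigcup_(w in [set w | walk_to n w]) [set u | adj w u])).
  move=> u [a [p [aA + <-]]]; case/lastP: p => [//|p w].
  rewrite rcons_path last_rcons size_rcons => /andP[ap pw] [sp].
  by exists (last a p) => //; exists a, p.
by apply: bigcup_finite => // w _; exact: adj_fin.
Qed.

Lemma ball_set_finite (n : nat) : finite_set (ball_set n).
Proof.
apply: (@sub_finite_set _ _
  (\bigcup_(m in [set m | (m < n.+1)%N]) [set u | walk_to m u])).
  by move=> u [m mn [mu _]]; exists m.
apply: bigcup_finite; first exact: finite_II.
by move=> m _; exact: walk_to_finite.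
Qed.

Lemma sphere_set_finite (n : nat) : finite_set (sphere_set n).
Proof.
by apply: sub_finite_set (ball_set_finite n) => u Hu; exists n.
Qed.

(* fset_set is meaningful here because of the two preceding lemmas. *)
Definition ball_to (n : nat) : {fset H} := fset_set (ball_set n).

Definition sphere_to (n : nat) : {fset H} := fset_set (sphere_set n).

End Distance.

(* For C included in B, this says that the restriction of s to C is t. *)
Definition restricts_to (V : choiceType) (X : eqType) (B C : {fset V})
    (s : {ffun B -> X}) (t : {ffun C -> X}) : bool :=
  [forall x : B, forall y : C, (val x == val y) ==> (s x == t y)].

Definition induced_adj (H : lfgraph) (B : {fset H}) : rel B :=
  fun x y => adj (val x) (val y).

Definition boundary_law (R : realType) (q : nat) (lambda beta : R)
    (H : lfgraph) (A : {fset H}) (n : nat)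
    (b : {ffun sphere_to A n -> spin q}) (t : {ffun A -> spin q}) : R :=
  gibbs_cond lambda beta (@induced_adj H (ball_to A n))
    (fun s => restricts_to s t) (fun s => restricts_to s b).

Definition max_discrepancy (R : realType) (q : nat) (lambda beta : R)
    (H : lfgraph) (A : {fset H}) (n : nat) : R :=
  sup [set r | exists b1 b2 : {ffun sphere_to A n -> spin q},
         r = dTV (boundary_law lambda beta b1) (boundary_law lambda beta b2)].

Definition uniqueness (R : realType) (q : nat) (lambda beta : R)
    (H : lfgraph) : Prop :=
  forall A : {fset H},
    (fun n : nat => max_discrepancy q lambda beta A n) @ \oo --> (0 : R).

(* Indices 1, ..., q-1 are represented by the ordinals 0, ..., q-2.
   - inl p is a vertex of an odd row: inl [::] is the root, and inl (l :: p) is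
     the vertex w_l added below the clique attached to the odd-row vertex inl p.
     It lies in row 2 * size p + 1.
   - inr (p, l) is the vertex u_l of the (q-1)-clique attached below inl p.
     It lies in row 2 * size p + 2. *)
Definition Gvertex (q : nat) : choiceType :=
  (seq 'I_q.-1 + seq 'I_q.-1 * 'I_q.-1)%type.

(* Adjacency of inl p and inr (p', l).  The ordinal successor ordS is cyclic,
   so the last u is joined to the first and to the last w. *)
Definition Gadj_odd_even (q : nat) (p p' : seq 'I_q.-1) (l : 'I_q.-1) : bool :=
  [|| p == p', p == l :: p' | p == ordS l :: p'].

Definition Gadj (q : nat) (x y : Gvertex q) : bool :=
  match x, y with
  | inl _, inl _ => false
  | inl p, inr (p', l) => Gadj_odd_even p p' l
  | inr (p', l), inl p => Gadj_odd_even p p' l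
  | inr (p, l), inr (p', l') => (p == p') && (l != l')
  end.

Lemma Gadj_sym (q : nat) : symmetric (@Gadj q).
Proof.
move=> [p|[p l]] [p'|[p' l']] //=.
by rewrite eq_sym [l == _]eq_sym.
Qed.

Lemma Gadj_irr (q : nat) : irreflexive (@Gadj q).
Proof. by move=> [p|[p l]] //=; rewrite !eqxx. Qed.

Lemma Gadj_fin (q : nat) (x : Gvertex q) : finite_set [set y | Gadj x y].
Proof.
pose s : seq (Gvertex q) := match x with
  | inl p => [seq inr (p, l) | l <- enum 'I_q.-1]
             ++ [seq inr (behead p, l) | l <- enum 'I_q.-1]
  | inr (p, l) => [:: inl p; inl (l :: p); inl (ordS l :: p)]
             ++ [seq inr (p, l') | l' <- enum 'I_q.-1]
  end.
apply: (@sub_finite_set _ _ [set` s]); last exact: finite_seq.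
rewrite {}/s; case: x => [p|[p l]] [p'|[p' l']] //=; rewrite ?mem_cat.
- move=> /or3P[] /eqP -> /=; apply/orP; [left|right|right];
    by apply/mapP; exists l'; rewrite ?mem_enum.
- by move=> /or3P[] /eqP ->; rewrite !inE eqxx ?orbT.
- by move=> /andP[/eqP <- _]; rewrite !inE /=; apply/mapP; exists l';
    rewrite ?mem_enum.
Qed.

Definition Ggraph (q : nat) : lfgraph :=
  LFGraph (@Gadj_sym q) (@Gadj_irr q) (@Gadj_fin q).

(* Main.v *)
Require Import Defs.
From mathcomp Require Import all_boot all_order all_algebra.
From mathcomp Require Import finmap.
From mathcomp Require Import all_classical all_reals all_analysis.
From mathcomp Require Import zify lra.
Import Order.TTheory GRing.Theory Num.Theory.
Import numFieldNormedType.Exports.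

Set Implicit Arguments.
Unset Strict Implicit.
Unset Printing Implicit Defensive.

Local Open Scope ring_scope.

(** Fix a colour c among the first two and give colour c to every vertex of
    the odd row at distance 2m from the root; the root then keeps colour c
    with probability close to 1, uniformly in m.  The boundary conditions
    built from the two choices of c therefore lead to root laws that stay at
    distance at least 1/8, which excludes uniqueness.

    Call block the set formed by an odd-row vertex v, the (q-1)-clique u
    attached below it and the vertices w below that clique.  Suppose that no
    edge of a block is penalized and that at most one w has a colour other
    than c.  Each u_l has two children w, so one of them has colour c; hence
    u_l avoids c, and it avoids the special state as well because that state
    is penalized next to c.  The clique thus uses each of the q - 1 other
    ordinary colours exactly once.  One of these is the other element of the
    first two colours, so v cannot take the special state either, and v = c
    ([clique_forces_root]).  A wrong colour at v costs a penalized edge, that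
    is a factor exp (- beta), or two wrong children.

    To turn this into an estimate, let Z_p(a) be the total weight of the
    configurations of the subtree below the odd vertex p, subject to the
    boundary condition and to colour a at p ([subtree_sum]).  The subtrees
    below distinct children are independent given the colours in the block,
    so Z_p is a sum, over the colours of the block, of a local weight times
    the product of the Z at the children ([subtree_sum_rec]).  If
    Z(a) <= eps Z(c) holds at the children for a <> c, each configuration
    of the block with a wrong root weighs at most
    e^(lambda q) max (eps^2, e^(- beta)) times the product P of the
    Z(c) at the children, while the correctly coloured block alone already
    contributes P to Z_p(c).  There are at most (q+1)^(2(q-1))
    configurations of the block, so with K = (q+1)^(2(q-1)) e^(lambda q) the
    bound Z(a) <= eps Z(c) reproduces itself for eps = 1/K as soon as
    e^(- beta) <= 1/K^2 ([subtree_sum_ratio]); this gives beta0 = 2 ln K. *)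

(** * Summing a weight over the spins of a set of vertices *)

Section Resummation.
Variables (T S : finType) (R : comNzRingType).
Implicit Types (D K : {set T}) (s t : {ffun T -> S}) (f g : {ffun T -> S} -> R).

Definition agree_off D s t := [forall x, (x \notin D) ==> (t x == s x)].

Definition resum D f s : R := \sum_(t | agree_off D s t) f t.

Definition depends_on K f :=
  forall s t, {in K, s =1 t} -> f s = f t.

Definition splice D s t : {ffun T -> S} := [ffun x => if x \in D then t x else s x].

Lemma agree_offP D s t :
  reflect (forall x, x \notin D -> t x = s x) (agree_off D s t).
Proof.
apply: (iffP forallP) => h x; first by move=> xD; apply/eqP/(implyP (h x)).
by apply/implyP => xD; apply/eqP/h.
Qed.

Lemma agree_off_refl D s : agree_off D s s.
Proof. exact/agree_offP. Qed.

Lemma card_agree_off D s :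
  #|[pred t | agree_off D s t]| = (#|S| ^ #|D|)%N.
Proof.
pose F x : pred S := if x \in D then predT else pred1 (s x).
transitivity #|family F|.
  apply: eq_card => t; rewrite !inE; apply/agree_offP/familyP => h x.
    by rewrite /F; case: (boolP (x \in D)) => // xD; rewrite inE h.
  by move=> xD; move: (h x); rewrite /F (negPf xD) inE => /eqP.
rewrite card_family foldrE big_map big_enum (bigID (mem D)) /=.
rewrite [X in (_ * X)%N]big1 ?muln1; last first.
  by move=> x xD; rewrite /F (negPf xD) card1.
by rewrite -prod_nat_const; apply: eq_bigr => x xD; rewrite /F xD.
Qed.

Lemma resumU D1 D2 f s : [disjoint D1 & D2] ->
  resum (D1 :|: D2) f s = resum D1 (resum D2 f) s.
Proof.
move=> D12; rewrite /resum.
rewrite (partition_big (splice D1 s) (agree_off D1 s)) /=; last first.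
  by move=> t _; apply/agree_offP => x xD; rewrite ffunE (negPf xD).
apply: eq_bigr => t /agree_offP st; apply: eq_bigl => t'.
apply/andP/agree_offP => [[/agree_offP st' /eqP <-] x xD2|tt'].
  by rewrite ffunE; case: ifP => // xD1; rewrite st' // inE xD1.
split; first by apply/agree_offP => x; rewrite inE negb_or => /andP[? ?];
  rewrite tt' ?st.
apply/eqP/ffunP => x; rewrite ffunE; case: ifPn => xD1; last by rewrite st.
by rewrite tt' // (disjointFr D12).
Qed.

(** Only the spins of [K] outside [D] survive the summation: two background
    configurations that agree there give sums over index sets in bijection by
    splicing. *)
Lemma resum_depends D K f : depends_on K f -> depends_on (K :\: D) (resum D f).
Proof.
move=> fK s t st; rewrite /resum.
rewrite (reindex_onto (splice D s) (splice D t)) /=; last first.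
  move=> u /agree_offP su; apply/ffunP => x; rewrite !ffunE.
  by case: (boolP (x \in D)) => // xD; rewrite su.
apply: eq_big => [u|u /andP[_ /eqP tu]].
  apply/andP/agree_offP => [[_ /eqP <-] x xD|tu].
    by rewrite !ffunE (negPf xD).
  split; first by apply/agree_offP => x xD; rewrite !ffunE (negPf xD).
  by apply/eqP/ffunP => x; rewrite !ffunE; case: (boolP (x \in D)) => // xD; rewrite tu.
apply: fK => x xK; rewrite ffunE; case: ifPn => // xD.
by rewrite -tu ffunE (negPf xD) st // inE xD.
Qed.

Lemma eq_resum D f g s : f =1 g -> resum D f s = resum D g s.
Proof. by move=> fg; apply: eq_bigr => t _. Qed.

(** A factor that does not see [D] is constant along the sum over [D]. *)
Lemma resumMl D K f g s : depends_on K g -> [disjoint D & K] ->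
  resum D (fun t => g t * f t) s = g s * resum D f s.
Proof.
move=> gK DK; rewrite /resum mulr_sumr; apply: eq_bigr => t /agree_offP st.
congr (_ * _); apply: gK => x xK; apply: st.
by rewrite (disjointFl DK xK).
Qed.

Lemma depends_prod (I : finType) (r : seq I) (K : I -> {set T}) (U : {set T})
    (f : I -> {ffun T -> S} -> R) :
  (forall i, i \in r -> K i \subset U) ->
  (forall i, depends_on (K i) (f i)) ->
  depends_on U (fun t => \prod_(i <- r) f i t).
Proof.
move=> KU fK s t st; rewrite !big_seq; apply: eq_bigr => i ir.
by apply: fK => x xK; apply: st; exact: (fintype.subsetP (KU i ir)).
Qed.

(** Conditional independence: factors seeing pairwise disjoint sets [K i] can
    be summed separately.  The spins outside the [D i] are frozen to those of
    [s]. *)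
Lemma resum_prod (I : finType) (r : seq I) (K D : I -> {set T})
    (f : I -> {ffun T -> S} -> R) s :
  uniq r -> (forall i j, i != j -> [disjoint K i & K j]) ->
  (forall i, D i \subset K i) -> (forall i, depends_on (K i) (f i)) ->
  resum (\bigcup_(i <- r) D i) (fun t => \prod_(i <- r) f i t) s =
  \prod_(i <- r) resum (D i) (f i) s.
Proof.
move=> + KK DK fK; elim: r s => [|i r IHr] s /=.
  move=> _; rewrite !big_nil /resum (big_pred1 s) ?big_nil // => t /=.
  apply/agree_offP/eqP => [h|-> //]; apply/ffunP => x.
  by apply: h; rewrite inE.
move=> /andP[ir ur]; rewrite !big_cons.
have Dr j : j \in r -> [disjoint K i & K j].
  by move=> jr; apply: KK; apply: contra ir => /eqP ->.
have Di : [disjoint K i & \bigcup_(j <- r) K j].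
  apply/pred0P => x /=; apply/negP => /andP[xi].
  rewrite finset.bigcup_seq => /bigcupP[j jr xj].
  by rewrite (disjointFr (Dr j jr) xi) in xj.
have DKr : \bigcup_(j <- r) D j \subset \bigcup_(j <- r) K j.
  rewrite !finset.bigcup_seq; apply/bigcupsP => j jr.
  by apply: (fintype.subset_trans (DK j)); apply: (finset.bigcup_sup j).
have Kr : depends_on (\bigcup_(j <- r) K j) (fun t => \prod_(j <- r) f j t).
  by apply: depends_prod fK => j jr; rewrite finset.bigcup_seq; apply: (finset.bigcup_sup j).
rewrite finset.setUC resumU; last first.
  rewrite disjoint_sym; apply: disjointWl (DK i) _.
  exact: disjointWr DKr Di.
under eq_resum => t.
  under eq_resum do rewrite big_cons mulrC.
  rewrite (resumMl _ _ Kr); last exact: disjointWl (DK i) Di.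
  rewrite mulrC; over.
rewrite (@resumMl _ (K i :\: D i)) ?IHr //.
  exact: resum_depends.
rewrite disjoint_sym; apply: disjointWl (finset.subsetDl _ _) _.
exact: disjointWr DKr Di.
Qed.

End Resummation.

(** * Rigidity of a clique and its children *)

Lemma eta_sym q (i j : spin q) : eta i j = eta j i.
Proof.
by rewrite /eta eq_sym [X in _ || X]orbC; case: eqVneq => //= ->.
Qed.

(** The colours [v], [u], [w] are those of an odd-row vertex, of the clique
    below it and of the next odd row.  The two children of each clique vertex
    make the conclusion robust to a single wrong [w]; this redundancy is what
    makes the error quadratic in the recursion. *)
Lemma clique_forces_root (q : nat) (c v : spin q) (u w : 'I_q.-1 -> spin q) :
  (2 < q)%N -> (c < 2)%N ->
  (forall l, ~~ eta v (u l)) ->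
  (forall l l', l != l' -> ~~ eta (u l) (u l')) ->
  (forall l, ~~ eta (u l) (w l)) ->
  (forall l, ~~ eta (u l) (w (ordS l))) ->
  (forall l l', w l != c -> w l' != c -> l = l') ->
  v = c.
Proof.
move=> q2 c2 vu uu uw uw' w1.
have ucq l : (u l != c) && (u l != ord_max).
  have hc (x : spin q) : ~~ eta x c -> (x != c) && (x != ord_max).
    rewrite /eta !negb_or -!(inj_eq val_inj) /= c2 andbT => /and3P[].
    by move=> + xq _; rewrite xq andbT; case: eqVneq => //= ->; lia.
  (* one of the two children of u_l has colour c *)
  have [wl|wl] := eqVneq (w l) c; first by apply: hc; rewrite -wl.
  suff wl' : w (ordS l) = c by apply: hc; rewrite -wl'.
  apply/eqP/negPn/negP => wl'; move: (w1 _ _ wl wl') => /(congr1 val) /=.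
  case: l {wl wl'} => l /= lq; have [e|e] := eqVneq l.+1 q.-1.
    by rewrite e modnn; lia.
  by rewrite modn_small; lia.
have ui : injective u.
  move=> l l' e; apply/eqP/negPn/negP => /uu.
  have /andP[_] := ucq l'; rewrite e /eta eqxx /= -(inj_eq val_inj) /=.
  by have := ltn_ord (u l'); lia.
have uimg : [set u l | l : 'I_q.-1] = [set x | (x != c) && (x != ord_max)].
  apply/eqP; rewrite eqEcard; apply/andP; split.
    by apply/fintype.subsetP => x /imsetP[l _ ->]; rewrite inE.
  rewrite card_imset // card_ord.
  have -> : [set x | (x != c) && (x != ord_max)] = ~: [set c; ord_max].
    by apply/setP => x; rewrite !inE negb_or.
  rewrite cardsCs finset.setCK cards2 card_ord.
  suff -> : c != ord_max by lia.
  by rewrite -(inj_eq val_inj) /=; lia.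
have hit x : x != c -> x != ord_max -> ~~ eta v x.
  move=> xc xq; have : x \in [set u l | l : 'I_q.-1] by rewrite uimg inE xc.
  by case/imsetP => l _ ->.
apply/eqP/negPn/negP => vc.
(* d is the other colour that is penalized next to the special state *)
pose d : spin q := inord (1 - c).
have dv : d = (1 - c)%N :> nat by rewrite inordK //; lia.
have [vq|vq] := eqVneq v ord_max.
  have := hit d; rewrite vq /eta -!(inj_eq val_inj) /= dv eqxx /=.
  by lia.
have := hit v vc vq; rewrite /eta eqxx /=.
by move: vq; rewrite -(inj_eq val_inj) /=; have := ltn_ord v; lia.
Qed.

(** * The Gibbs weight of a ball as a product over subtrees *)

Lemma suffix_eq_size (I : eqType) (p p' r : seq I) :
  suffix p r -> suffix p' r -> size p = size p' -> p = p'.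
Proof.
by rewrite !suffixE => /eqP + /eqP + e; rewrite e => -> ->.
Qed.

Lemma suffix_cons_self (I : eqType) (l : I) (p : seq I) : suffix (l :: p) p = false.
Proof. by apply/negP => /size_suffix /=; rewrite ltnn. Qed.

Lemma suffix_step (I : finType) (p r : seq I) : suffix p r -> r != p ->
  exists l, suffix (l :: p) r.
Proof.
move=> /suffixP[z ->]; case/lastP: z => [|z l]; first by rewrite eqxx.
by exists l; rewrite cat_rcons suffix_suffix.
Qed.

(** A list ending with [p] is either [p] itself or ends with [l :: p] for
    exactly one [l]; with [p] read as a vertex of an odd row, this splits the
    subtree below [p] into the block of [p] and the subtrees below the
    vertices [l :: p]. *)
Lemma big_suffix (R : Type) (idx : R) (op : Monoid.com_law idx)
    (I X : finType) (key : X -> seq I) (P : pred X) (h : X -> R) (p : seq I) :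
  \big[op/idx]_(x | P x && suffix p (key x)) h x =
  op (\big[op/idx]_(x | P x && (key x == p)) h x)
     (\big[op/idx]_(l : I) \big[op/idx]_(x | P x && suffix (l :: p) (key x)) h x).
Proof.
under [X in op _ X]eq_bigr do rewrite big_mkcondr.
rewrite exchange_big big_mkcondr [X in op X _]big_mkcondr /= -big_split /=.
apply: eq_bigr => x _; case: (eqVneq (key x) p) => [->|kp].
  rewrite suffix_refl big1 ?Monoid.mulm1 // => l _.
  by rewrite suffix_cons_self.
rewrite Monoid.mul1m; case: ifPn => [pk|npk].
  have [l lk] := suffix_step pk kp.
  rewrite (bigD1 l) //= lk big1 ?Monoid.mulm1 // => l' l'l.
  case: ifP => // l'k; move: l'l.
  by have [->] := suffix_eq_size l'k lk erefl; rewrite eqxx.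
rewrite big1 // => l _; case: ifP => // lk; move: npk.
by rewrite (suffix_trans (suffix_cons p l) lk).
Qed.

Definition level (q : nat) (x : Gvertex q) : nat :=
  match x with inl p => (size p).*2 | inr (p, _) => (size p).*2.+1 end.

(** Every vertex and every edge is charged to one odd-row vertex: a vertex of
    an odd row to itself, a clique vertex to the vertex it hangs from. *)
Definition stem (q : nat) (x : Gvertex q) : seq 'I_q.-1 :=
  match x with inl p => p | inr (p, _) => p end.

(** Every edge has an end in an even row, and that end determines the block;
    if both ends are in even rows they lie in the same clique. *)
Definition block_of_edge (q : nat) (x y : Gvertex q) : seq 'I_q.-1 :=
  if x is inr (p, _) then p else stem y.

Lemma edge_ends (q : nat) (x y : Gvertex q) p :
  Gadj x y -> block_of_edge x y = p ->
  (stem x = p \/ exists l, x = inl (l :: p)) /\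
  (stem y = p \/ exists l, y = inl (l :: p)).
Proof.
move: x y => [p1|[p1 l1]] [p2|[p2 l2]] //= + <-.
- by case/or3P => /eqP ->; split; (try by left); right; eexists.
- by case/or3P => /eqP ->; split; (try by left); right; eexists.
- by case/andP => /eqP -> _; split; left.
Qed.

Lemma block_of_edge_sym (q : nat) (x y : Gvertex q) :
  Gadj x y -> block_of_edge x y = block_of_edge y x.
Proof.
by move: x y => [p|[p l]] [p'|[p' l']] //= /andP[/eqP].
Qed.

Section Ball.
Variables (R : realType) (q : nat) (lambda beta : R) (c : spin q) (m : nat).
Variables (B : {fset Gvertex q}).
Hypothesis memB : forall x, (x \in B) = (level x <= m.*2)%N.
Implicit Types (p : seq 'I_q.-1) (s t : {ffun B -> spin q}).

Lemma root_in_ball : (inl [::] : Gvertex q) \in B. Proof. by rewrite memB. Qed.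

Definition root_vertex : B := [` root_in_ball]%fset.

(* The root is the default value when the vertex lies outside the ball. *)
Definition odd_vertex p : B := insubd root_vertex (inl p : Gvertex q).
Definition even_vertex p l : B := insubd root_vertex (inr (p, l) : Gvertex q).

Lemma val_odd_vertex p : (size p <= m)%N -> fsval (odd_vertex p) = inl p.
Proof. by move=> pm; rewrite [LHS]insubdK // memB /= leq_double. Qed.

Lemma val_even_vertex p l : (size p < m)%N -> fsval (even_vertex p l) = inr (p, l).
Proof. by move=> pm; rewrite [LHS]insubdK // memB /= ltn_double. Qed.

Lemma odd_vertexE p (x : B) : fsval x = inl p -> x = odd_vertex p.
Proof. by move=> xp; apply: val_inj; rewrite [RHS]insubdK //= -xp; apply: valP. Qed.

Lemma even_vertexE p l (x : B) : fsval x = inr (p, l) -> x = even_vertex p l.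
Proof. by move=> xp; apply: val_inj; rewrite [RHS]insubdK //= -xp; apply: valP. Qed.

(** The second factor is the indicator of the boundary condition at [x]. *)
Definition site (x : B) (a : spin q) : R :=
  expR (lambda * (a == q :> nat)%:R) *
  ((level (fsval x) == m.*2) ==> (a == c))%:R.

(** The edges are indexed by ordered pairs, so that each one occurs twice;
    hence the factor 1/2. *)
Definition bond (a b : spin q) : R := expR (- (beta * 2^-1) * (eta a b)%:R).

Definition adj_in_ball (e : B * B) := Gadj (fsval e.1) (fsval e.2).
Definition vertex_block (x : B) := stem (fsval x).
Definition edge_block (e : B * B) := block_of_edge (fsval e.1) (fsval e.2).

Definition block_weight p s : R :=
  (\prod_(x : B | vertex_block x == p) site x (s x)) *
  \prod_(e : B * B | adj_in_ball e && (edge_block e == p)) bond (s e.1) (s e.2).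

Definition subtree_weight p s : R :=
  (\prod_(x : B | suffix p (vertex_block x)) site x (s x)) *
  \prod_(e : B * B | adj_in_ball e && suffix p (edge_block e)) bond (s e.1) (s e.2).

Lemma subtree_weight_rec p s : subtree_weight p s =
  block_weight p s * \prod_l subtree_weight (l :: p) s.
Proof.
rewrite /subtree_weight (big_suffix _ vertex_block xpredT) (big_suffix _ edge_block) /=.
by rewrite mulrACA -big_split.
Qed.

Definition subtree p : {set B} := [set x | suffix p (vertex_block x)].
Definition below p : {set B} := [set x in subtree p | fsval x != inl p].
(** The spins of the block of [p] that are summed over: the clique below
    [p] and the odd vertices below that clique. *)
Definition block p : {set B} := below p :\: \bigcup_l below (l :: p).

Lemma below_subtree p : below p \subset subtree p.
Proof. by apply/fintype.subsetP => x; rewrite inE => /andP[]. Qed.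

Lemma subtree_disjoint p (l l' : 'I_q.-1) : l != l' ->
  [disjoint subtree (l :: p) & subtree (l' :: p)].
Proof.
move=> ll'; apply/pred0P => x /=; rewrite !inE; apply/negP => /andP[h h'].
by have [e] := suffix_eq_size h h' erefl; rewrite e eqxx in ll'.
Qed.

Lemma below_split p : below p = block p :|: \bigcup_l below (l :: p).
Proof.
rewrite /block finset.setUC -[LHS](finset.setID _ (\bigcup_l below (l :: p))).
congr (_ :|: _); apply/finset.setIidPr/bigcupsP => l _.
apply/fintype.subsetP => x; rewrite !inE => /andP[lx _].
rewrite (suffix_trans (suffix_cons p l) lx) /=.
apply: contraTneq lx => xp; rewrite /vertex_block xp /=.
by rewrite suffix_cons_self.
Qed.

Lemma card_block p : (#|block p| <= (q.-1).*2)%N.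
Proof.
pose X := [set even_vertex p l | l : 'I_q.-1] :|:
  [set odd_vertex (l :: p) | l : 'I_q.-1].
have XS : block p \subset X.
  apply/fintype.subsetP => x; rewrite inE => /andP[xU]; rewrite !inE.
  case/andP => px xp.
  have [e|ne] := eqVneq (vertex_block x) p.
    apply/orP; left; move: e xp; rewrite /vertex_block.
    case xE: (fsval x) => [p'|[p' l]] e; first by rewrite -e eqxx.
    by move=> _; apply/imsetP; exists l => //; apply: even_vertexE; rewrite xE -e.
  have [l lx] := suffix_step px ne; apply/orP; right.
  apply/imsetP; exists l => //; apply: odd_vertexE; apply/eqP.
  apply: contraNT xU => xl; apply/finset.bigcupP; exists l => //.
  by rewrite !inE lx.
apply: leq_trans (subset_leq_card XS) _.
apply: leq_trans (leq_card_setU _ _).1 _; rewrite -addnn.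
by rewrite leq_add // (leq_trans (leq_imset_card _ _)) // card_ord.
Qed.

(** The block of [p] meets the subtree of [l :: p] only at [l :: p] itself,
    which is not strictly below [l :: p]. *)
Lemma block_weight_depends p :
  depends_on (~: \bigcup_l below (l :: p)) (block_weight p).
Proof.
have out (x : B) : stem (fsval x) = p \/ (exists l, fsval x = inl (l :: p)) ->
    x \in ~: \bigcup_l below (l :: p).
  move=> h; rewrite inE; apply/negP => /finset.bigcupP[l _]; rewrite !inE /vertex_block.
  case: h => [->|[l' ->]] /=; first by rewrite suffix_cons_self.
  case/andP => /suffix_eq_size /(_ (suffix_refl _) erefl) ->.
  by rewrite eqxx.
move=> s t st; congr (_ * _); apply: eq_bigr.
  by move=> x /eqP xp; rewrite st //; apply: out; left.
move=> [x y] /andP[xy /eqP e] /=; have [hx hy] := edge_ends xy e.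
by rewrite !st //; apply: out.
Qed.

Lemma subtree_weight_depends p : depends_on (subtree p) (subtree_weight p).
Proof.
have into (x : B) r : suffix p r ->
    stem (fsval x) = r \/ (exists l, fsval x = inl (l :: r)) -> x \in subtree p.
  move=> pr; rewrite inE /vertex_block => -[->//|[l ->]] /=.
  exact: suffix_trans pr (suffix_cons _ _).
move=> s t st; congr (_ * _); apply: eq_bigr.
  by move=> x px; rewrite st // inE.
move=> [x y] /andP[xy pe] /=; have [hx hy] := edge_ends xy erefl.
by rewrite !st //; apply: into pe _.
Qed.

(** The partition function of the subtree of [p]; by [subtree_sum_local] it
    depends on [s] only through the colour of [p]. *)
Definition subtree_sum p s : R := resum (below p) (subtree_weight p) s.

(** Once the spins of the block are fixed, the subtrees hanging from it are
    independent. *)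
Lemma subtree_sum_rec p s : subtree_sum p s =
  \sum_(t | agree_off (block p) s t)
    block_weight p t * \prod_l subtree_sum (l :: p) t.
Proof.
rewrite /subtree_sum below_split resumU; last first.
  apply/pred0P => x /=; rewrite finset.in_setD.
  by rewrite [_ && (x \in below p)]andbC -andbA andNb andbF.
apply: eq_bigr => t _.
under eq_resum do rewrite subtree_weight_rec.
rewrite (resumMl _ _ (@block_weight_depends p)); last first.
  by apply/pred0P => x /=; rewrite !inE andbN.
congr (_ * _); apply: (resum_prod (K := fun l => subtree (l :: p))).
- exact: index_enum_uniq.
- exact: subtree_disjoint.
- by move=> l; apply: below_subtree.
- by move=> l; apply: subtree_weight_depends.
Qed.

Lemma subtree_sum_local p s t :
  s (odd_vertex p) = t (odd_vertex p) -> subtree_sum p s = subtree_sum p t.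
Proof.
move=> st; apply: resum_depends (@subtree_weight_depends p) _ _ _ => x.
rewrite !inE => /andP[+ px]; rewrite px /= negbK => /eqP /odd_vertexE ->.
exact: st.
Qed.

Definition boundary_ok s : bool :=
  [forall x : B, (level (fsval x) == m.*2) ==> (s x == c)].

(** At the root the subtree is the whole ball, so the weight is the Gibbs
    weight restricted to the boundary condition. *)
Lemma subtree_weight_root s : subtree_weight [::] s =
  expR (energy lambda beta (@induced_adj (Ggraph q) B) s) * (boundary_ok s)%:R.
Proof.
have -> : (boundary_ok s)%:R =
    \prod_(x : B) ((level (fsval x) == m.*2) ==> (s x == c))%:R :> R.
  case: (boolP (boundary_ok s)) => [/forallP h|].
    by rewrite big1 // => x _; rewrite (h x).
  by rewrite negb_forall => /existsP[x nx]; rewrite (bigD1 x) //= (negPf nx) mul0r.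
rewrite /energy expRD [in RHS]mulrAC /subtree_weight.
rewrite mulr_sumr expR_sum -big_split /=.
under [in LHS]eq_bigl do rewrite suffix0s.
congr (_ * _).
rewrite -mulNr mulrA pair_big_dep /= mulr_sumr expR_sum.
apply: eq_big => [e|e _]; first by rewrite suffix0s andbT.
by rewrite /bond !mulNr.
Qed.

Lemma sum_boundary_ok a :
  \sum_(s : {ffun B -> spin q} | (s root_vertex == a) && boundary_ok s)
     expR (energy lambda beta (@induced_adj (Ggraph q) B) s) =
  subtree_sum [::] [ffun=> a].
Proof.
have odd_nil : odd_vertex [::] = root_vertex.
  by apply: val_inj; rewrite /= val_odd_vertex.
rewrite /subtree_sum /resum big_mkcondr; apply: eq_big => [s|s _].
  apply/eqP/agree_offP => [sa x|sa].
    rewrite !inE suffix0s /= negbK => /eqP /odd_vertexE ->.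
    by rewrite odd_nil sa ffunE.
  by rewrite sa ?ffunE // !inE /= ?eqxx ?andbF.
by rewrite subtree_weight_root; case: ifP; rewrite ?mulr1 ?mulr0.
Qed.

(** * Domination of the boundary colour *)

Hypotheses (q2 : (2 < q)%N) (c2 : (c < 2)%N).
Hypotheses (lambda_ge0 : 0 <= lambda) (beta_ge0 : 0 <= beta).

Lemma site_ge0 x a : 0 <= site x a.
Proof. by rewrite mulr_ge0 ?expR_ge0. Qed.

Lemma site_le x a : site x a <= expR lambda.
Proof.
rewrite /site; case: (_ ==> _); last by rewrite mulr0 expR_ge0.
rewrite mulr1 ler_expR; case: (_ == _); first by rewrite mulr1.
by rewrite mulr0.
Qed.

Lemma bond_gt0 a b : 0 < bond a b.
Proof. exact: expR_gt0. Qed.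

Lemma bond_le1 a b : bond a b <= 1.
Proof. by rewrite expR_le1 mulNr oppr_le0 !mulr_ge0 ?invr_ge0. Qed.

Lemma card_stem p : (#|[pred x | vertex_block x == p]| <= q)%N.
Proof.
pose X := odd_vertex p |: [set even_vertex p l | l : 'I_q.-1].
have XS : [pred x | vertex_block x == p] \subset X.
  apply/fintype.subsetP => x; rewrite !inE /vertex_block.
  case xE: (fsval x) => [p'|[p' l]] /eqP /= e; rewrite e in xE.
    by rewrite (odd_vertexE xE) eqxx.
  by rewrite (even_vertexE xE) imset_f ?orbT.
apply: leq_trans (subset_leq_card XS) _.
rewrite cardsU1; apply: leq_trans (leq_add (leq_b1 _) (leq_imset_card _ _)) _.
by rewrite card_ord; lia.
Qed.

Lemma site_prod_le p s :
  \prod_(x : B | vertex_block x == p) site x (s x) <= expR lambda ^+ q.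
Proof.
apply: (@le_trans _ _ (\prod_(x : B | vertex_block x == p) expR lambda)).
  by apply: ler_prod => x _; rewrite site_ge0 site_le.
rewrite prodr_const; apply: ler_weXn2l (card_stem p).
by rewrite -expR0 ler_expR.
Qed.

Lemma block_weight_ge0 p s : 0 <= block_weight p s.
Proof.
rewrite mulr_ge0 // prodr_ge0 // => x _; first exact: site_ge0.
exact/ltW/bond_gt0.
Qed.

Lemma block_weight_le p s : block_weight p s <= expR lambda ^+ q.
Proof.
rewrite -[leRHS]mulr1 ler_pM ?site_prod_le ?prodr_ge0 //.
- by move=> x _; apply: site_ge0.
- by move=> x _; apply/ltW/bond_gt0.
by apply: prodr_ile1 => e _; rewrite ltW ?bond_gt0 ?bond_le1.
Qed.

Lemma block_weight_le_violation p s x y :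
  adj_in_ball (x, y) -> edge_block (x, y) = p -> eta (s x) (s y) ->
  block_weight p s <= expR lambda ^+ q * expR (- beta).
Proof.
move=> xy xyp sxy; rewrite ler_pM ?site_prod_le ?prodr_ge0 //.
- by move=> ? _; apply: site_ge0.
- by move=> ? _; apply/ltW/bond_gt0.
have yx : adj_in_ball (y, x) by rewrite /adj_in_ball Gadj_sym.
have yxp : edge_block (y, x) = p by rewrite -xyp; apply: block_of_edge_sym.
(* each of the two orientations of the edge contributes exp (- beta / 2) *)
rewrite (bigD1 (x, y)) ?xy ?xyp ?eqxx //= (bigD1 (y, x)) /=; last first.
  rewrite yx yxp eqxx /=; apply: contraTneq xy => -[-> _].
  by rewrite /adj_in_ball Gadj_irr.
rewrite mulrA -[leRHS]mulr1 ler_pM ?prodr_ge0 ?mulr_ge0 ?(ltW (bond_gt0 _ _)) //.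
- by move=> ? _; apply/ltW/bond_gt0.
- rewrite /bond (eta_sym (s y)) sxy -expRD ler_expR /= !mulr1; lra.
by apply: prodr_ile1 => e _; rewrite ltW ?bond_gt0 ?bond_le1.
Qed.

Definition ground : {ffun B -> spin q} := [ffun=> c].

(** This enumerates the ordinary colours other than [c]. *)
Definition clique_color (l : 'I_q.-1) : spin q := inord (bump c l).

Lemma clique_colorE l : clique_color l = bump c l :> nat.
Proof. by rewrite inordK // /bump; have := ltn_ord l; lia. Qed.

(** The configuration behind the main term of the recursion: it has neither a
    penalized edge nor the special state in the block of [p], and every other
    spin is [c]. *)
Definition good_block p : {ffun B -> spin q} :=
  [ffun x : B => if fsval x is inr (p', l) then
     if p' == p then clique_color l else c else c].

Lemma good_block_agree p : (size p < m)%N ->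
  agree_off (block p) ground (good_block p).
Proof.
move=> pm; apply/agree_offP => x xb; rewrite !ffunE.
case xE: (fsval x) => [//|[p' l]]; case: eqP => // p'p; move: xb.
rewrite !inE /vertex_block xE p'p suffix_refl /= negb_and negbK orbF.
case/finset.bigcupP => l' _; rewrite !inE /vertex_block xE /= p'p.
by rewrite suffix_cons_self.
Qed.

Lemma eta_clique_color l : eta (clique_color l) c = false.
Proof.
rewrite /eta -!(inj_eq val_inj) /= clique_colorE /bump.
by have := ltn_ord l; lia.
Qed.

Lemma eta_clique_colors l l' : l != l' ->
  eta (clique_color l) (clique_color l') = false.
Proof.
rewrite /eta -!(inj_eq val_inj) /= !clique_colorE /bump.
by have := ltn_ord l; have := ltn_ord l'; lia.
Qed.

Lemma good_block_weight p : block_weight p (good_block p) = 1.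
Proof.
rewrite /block_weight !big1 ?mulr1 // => [|x /eqP xp].
  move=> [x y] /andP[+ /eqP]; rewrite /adj_in_ball /edge_block /bond !ffunE /=.
  case: (fsval x) (fsval y) => [p1|[p1 l1]] [p2|[p2 l2]] //= + e.
  - by rewrite e eqxx eta_sym eta_clique_color mulr0 expR0.
  - by rewrite e eqxx eta_clique_color mulr0 expR0.
  case/andP => /eqP <- l12; rewrite e eqxx.
  by rewrite eta_clique_colors // mulr0 expR0.
rewrite /site ffunE; move: xp; rewrite /vertex_block; case: (fsval x) => [p'|[p' l]] /= ->.
  by rewrite eqxx implybT mulr1 (ltn_eqF (ltn_trans c2 q2)) mulr0 expR0.
have -> : ((size p).*2.+1 == m.*2) = false by lia.
have lq : (bump c l < q)%N by rewrite /bump; have := ltn_ord l; lia.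
by rewrite eqxx clique_colorE (ltn_eqF lq) mulr0 expR0 mulr1.
Qed.

Lemma subtree_weight_ge0 p s : 0 <= subtree_weight p s.
Proof.
rewrite mulr_ge0 // prodr_ge0 // => x _; first exact: site_ge0.
exact/ltW/bond_gt0.
Qed.

Lemma subtree_sum_ge0 p s : 0 <= subtree_sum p s.
Proof. by apply: sumr_ge0 => t _; apply: subtree_weight_ge0. Qed.

Lemma subtree_sum_ground_gt0 p : 0 < subtree_sum p ground.
Proof.
rewrite /subtree_sum /resum (bigD1 ground) ?agree_off_refl //=.
apply: ltr_pwDl; last by apply: sumr_ge0 => t _; apply: subtree_weight_ge0.
rewrite mulr_gt0 // prodr_gt0 // => x _; last exact: bond_gt0.
by rewrite /site ffunE eqxx implybT mulr1 expR_gt0.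
Qed.

(** The contrapositive of [clique_forces_root] in the block of [p]. *)
Lemma violated_edge p s : (size p < m)%N -> s (odd_vertex p) != c ->
  (forall l l', s (odd_vertex (l :: p)) != c ->
     s (odd_vertex (l' :: p)) != c -> l = l') ->
  exists x y, [/\ adj_in_ball (x, y), edge_block (x, y) = p & eta (s x) (s y)].
Proof.
move=> pm sp one.
have [|no] := boolP [exists e : B * B,
  [&& adj_in_ball e, edge_block e == p & eta (s e.1) (s e.2)]].
  by case/existsP => -[x y] /and3P[? /eqP ? ?]; exists x, y.
have val_odd r : (size r <= m)%N -> fsval (odd_vertex r) = inl r by exact: val_odd_vertex.
have val_even l : fsval (even_vertex p l) = inr (p, l) by exact: val_even_vertex.
have ok x y : adj_in_ball (x, y) -> edge_block (x, y) = p -> ~~ eta (s x) (s y).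
  move=> xy xyp; apply: contra no => sxy; apply/existsP; exists (x, y).
  by rewrite xy xyp eqxx.
case/eqP: sp.
apply: (clique_forces_root (u := fun l => s (even_vertex p l))
  (w := fun l => s (odd_vertex (l :: p)))) => // [l|l l' ll'|l|l]; apply: ok;
  rewrite /adj_in_ball /edge_block /= ?val_even ?val_odd //= /Gadj_odd_even
    ?eqxx ?orbT //; exact: ltnW.
Qed.

(** Induction on the distance [k] from [p] to the boundary, counted in pairs
    of rows. *)
Lemma subtree_sum_ratio (eps : R) : 0 < eps -> eps <= 1 ->
  q.+1%:R ^+ (q.-1).*2 * expR lambda ^+ q * eps <= 1 ->
  expR (- beta) <= eps ^+ 2 ->
  forall k p t, (size p + k = m)%N -> t (odd_vertex p) != c ->
  subtree_sum p t <= eps * subtree_sum p ground.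
Proof.
move=> eps0 eps1 Keps beps; elim=> [|k IHk] p t.
  (* p lies on the boundary, where any colour other than c has weight 0 *)
  rewrite addn0 => pm tc; rewrite /subtree_sum /resum big1.
    by rewrite mulr_ge0 ?ltW ?subtree_sum_ground_gt0.
  move=> t' /agree_offP tt'; rewrite /subtree_weight.
  rewrite (bigD1 (odd_vertex p)) /=; last first.
    by rewrite /vertex_block val_odd_vertex ?pm // suffix_refl.
  rewrite tt' ?inE ?val_odd_vertex ?pm ?eqxx ?andbF //.
  by rewrite /site val_odd_vertex ?pm //= pm eqxx (negPf tc) mulr0 !mul0r.
move=> pm tc; have {}pm' : (size p < m)%N by lia.
set P := \prod_l subtree_sum (l :: p) ground.
have P0 : 0 < P by apply: prodr_gt0 => l _; apply: subtree_sum_ground_gt0.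
(* keep only the term of the good block *)
have lower : P <= subtree_sum p ground.
  rewrite subtree_sum_rec (bigD1 (good_block p)) ?good_block_agree //=.
  rewrite good_block_weight mul1r.
  apply: ler_wpDr.
    apply: sumr_ge0 => t' _; rewrite mulr_ge0 ?block_weight_ge0 //.
    by apply: prodr_ge0 => l _; apply: subtree_sum_ge0.
  rewrite le_eqVlt; apply/orP; left; apply/eqP; apply: eq_bigr => l _.
  by apply: subtree_sum_local; rewrite !ffunE val_odd_vertex.
have Zle t' l : subtree_sum (l :: p) t' <=
    (if t' (odd_vertex (l :: p)) != c then eps else 1) *
    subtree_sum (l :: p) ground.
  case: ifPn => [|/negPn/eqP] tl; first by apply: IHk => //=; lia.
  by rewrite mul1r le_eqVlt; apply/orP; left; apply/eqP/subtree_sum_local; rewrite ffunE.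
have Zle1 t' l : subtree_sum (l :: p) t' <= subtree_sum (l :: p) ground.
  apply: le_trans (Zle t' l) _; rewrite ger_pMl ?subtree_sum_ground_gt0 //.
  by case: ifP.
have PZle t' : \prod_l subtree_sum (l :: p) t' <= P.
  by apply: ler_prod => l _; rewrite subtree_sum_ge0 Zle1.
have E0 : 0 <= expR lambda ^+ q by rewrite exprn_ge0 ?expR_ge0.
(* two wrong children cost eps^2; otherwise some edge is penalized *)
have upper t' : agree_off (block p) t t' ->
    block_weight p t' * \prod_l subtree_sum (l :: p) t' <= expR lambda ^+ q * eps ^+ 2 * P.
  move=> /agree_offP tt'.
  have t'c : t' (odd_vertex p) != c.
    by rewrite tt' // !inE val_odd_vertex ?eqxx ?andbF // ltnW.
  have [/existsP[l /existsP[l' /and3P[ll' wl wl']]]|one] :=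
    boolP [exists l, exists l',
      [&& l' != l, t' (odd_vertex (l :: p)) != c & t' (odd_vertex (l' :: p)) != c]].
    rewrite -mulrA ler_pM ?block_weight_ge0 ?block_weight_le //.
      by apply: prodr_ge0 => ? _; apply: subtree_sum_ge0.
    rewrite /P (bigD1 l) // (bigD1 l') //= [X in _ <= _ * X](bigD1 l) //=.
    rewrite [X in _ <= _ * (_ * X)](bigD1 l') //=.
    have hl := Zle t' l; have hl' := Zle t' l'; rewrite wl in hl; rewrite wl' in hl'.
    have hr : \prod_(i | (i != l) && (i != l')) subtree_sum (i :: p) t' <=
        \prod_(i | (i != l) && (i != l')) subtree_sum (i :: p) ground.
      by apply: ler_prod => i _; rewrite subtree_sum_ge0 Zle1.
    have Zr0 : 0 <= \prod_(i | (i != l) && (i != l')) subtree_sum (i :: p) t'.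
      by apply: prodr_ge0 => i _; apply: subtree_sum_ge0.
    apply: le_trans (ler_pM _ _ hl (ler_pM _ _ hl' hr)) _; rewrite ?subtree_sum_ge0 //.
      by rewrite mulr_ge0 ?subtree_sum_ge0.
    by rewrite -[X in _ * X <= _]mulrA mulrACA expr2.
  have [x [y [xy xyp sxy]]] : exists x y,
      [/\ adj_in_ball (x, y), edge_block (x, y) = p & eta (t' x) (t' y)].
    apply: violated_edge => // l l' wl wl'; apply/eqP; apply: contraNT one => ll'.
    by apply/existsP; exists l; apply/existsP; exists l'; rewrite eq_sym ll' wl wl'.
  rewrite ler_pM ?block_weight_ge0 //.
    by apply: prodr_ge0 => ? _; apply: subtree_sum_ge0.
  apply: le_trans (block_weight_le_violation xy xyp sxy) _.
  exact: ler_wpM2l.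
rewrite subtree_sum_rec; apply: le_trans (ler_sum _ upper) _.
rewrite sumr_const card_agree_off card_ord -mulr_natl.
apply: (@le_trans _ _ (eps * P)); last by rewrite ler_pM2l.
rewrite expr2 -!mulrA (mulrA _ eps) (mulrA _ _ (eps * P)).
apply: ler_piMl; first by rewrite mulr_ge0 ?ltW.
apply: le_trans _ Keps; rewrite -mulrA ler_wpM2r ?mulr_ge0 ?(ltW eps0) //.
by rewrite -natrX ler_nat leq_pexp2l // card_block.
Qed.

End Ball.

(** * Distances from the root *)

Definition root_set (q : nat) : {fset Ggraph q} := [fset (inl [::] : Gvertex q)]%fset.

Lemma walk_to_step (H : lfgraph) (A : {fset H}) n (u w : H) :
  walk_to A n u -> adj u w -> walk_to A n.+1 w.
Proof.
move=> [a [p [aA pth lst sz]]] uw; exists a, (rcons p w).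
by split; rewrite ?rcons_path ?last_rcons ?size_rcons ?sz // pth lst.
Qed.

Lemma walk_to_level q (x : Ggraph q) : walk_to (root_set q) (level x) x.
Proof.
have odd p : walk_to (root_set q) (size p).*2 (inl p : Ggraph q).
  elim: p => [|l p IHp] /=.
    by exists (inl [::]), [::]; split => //; rewrite inE.
  rewrite doubleS; apply: (@walk_to_step _ _ _ (inr (p, l) : Ggraph q)).
    by apply: walk_to_step IHp _; rewrite /= /Gadj_odd_even eqxx.
  by rewrite /= /Gadj_odd_even eqxx orbT.
case: x => [p|[p l]] //=; apply: walk_to_step (odd p) _.
by rewrite /= /Gadj_odd_even eqxx.
Qed.

Lemma Gadj_level q (x y : Gvertex q) : Gadj x y -> (level y <= (level x).+1)%N.
Proof.
move: x y => [p|[p l]] [p'|[p' l']] //=; last by case/andP => /eqP -> _.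
  by case/or3P => /eqP -> /=; lia.
by case/or3P => /eqP -> /=; lia.
Qed.

Lemma level_le_walk q n (x : Ggraph q) :
  walk_to (root_set q) n x -> (level x <= n)%N.
Proof.
move=> [a [p [+ + <- <-]]]; rewrite inE => /eqP ->.
elim/last_ind: p => [//|p w IHp].
rewrite rcons_path last_rcons size_rcons => /andP[/IHp h /Gadj_level].
by move=> /leq_trans; apply.
Qed.

(** An edge changes the level by at most one and the walk down the tree
    attains the level, so the level is the distance to the root. *)
Lemma dist_to_level q n (x : Ggraph q) : dist_to (root_set q) x n <-> level x = n.
Proof.
split=> [[w h]|<-].
  apply/eqP; rewrite eqn_leq level_le_walk //= leqNgt.
  by apply/negP => /h; apply; apply: walk_to_level.
split; first exact: walk_to_level.
by move=> k kn /level_le_walk; rewrite leqNgt kn.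
Qed.

Lemma mem_ball q n (x : Ggraph q) :
  (x \in ball_to (root_set q) n) = (level x <= n)%N.
Proof.
rewrite /ball_to in_fset_set; last exact: ball_set_finite.
apply/idP/idP => [|xn]; first by rewrite inE => -[k kn /dist_to_level ->].
by rewrite inE; exists (level x) => //; apply/dist_to_level.
Qed.

Lemma mem_sphere q n (x : Ggraph q) :
  (x \in sphere_to (root_set q) n) = (level x == n).
Proof.
rewrite /sphere_to in_fset_set; last exact: sphere_set_finite.
apply/idP/eqP => [|xn]; first by rewrite inE => /dist_to_level.
by rewrite inE; apply/dist_to_level.
Qed.

(** * Laws at the root and non-uniqueness *)

Section RootLaw.
Variables (R : realType) (q : nat) (lambda beta : R) (m : nat).

Let B := ball_to (root_set q) m.*2.

Lemma in_root_ball (x : Gvertex q) : (x \in B) = (level x <= m.*2)%N.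
Proof. exact: mem_ball. Qed.

Definition root_partition (c a : spin q) : R :=
  subtree_sum lambda beta c m [::] ([ffun=> a] : {ffun B -> spin q}).

Definition const_boundary (c : spin q) :
  {ffun sphere_to (root_set q) m.*2 -> spin q} := [ffun=> c].

Definition root_config (a : spin q) : {ffun root_set q -> spin q} := [ffun=> a].

Lemma restricts_const_boundary (c : spin q) (s : {ffun B -> spin q}) :
  restricts_to s (const_boundary c) = boundary_ok c m s.
Proof.
apply/forallP/forallP => h x.
  apply/implyP => xm.
  have xS : fsval x \in sphere_to (root_set q) m.*2 by rewrite mem_sphere.
  by have /forallP/(_ [` xS]%fset)/implyP/(_ (eqxx _)) := h x; rewrite ffunE.
apply/forallP => y; apply/implyP => /eqP xy; rewrite ffunE.
apply: (implyP (h x)); rewrite -mem_sphere.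
by have := fsvalP y; rewrite -[fsval y]xy.
Qed.

Lemma restricts_root_config (a : spin q) (s : {ffun B -> spin q}) :
  restricts_to s (root_config a) = (s (root_vertex in_root_ball) == a).
Proof.
apply/forallP/eqP => [h|sa x].
  have r0 : (inl [::] : Gvertex q) \in root_set q by rewrite inE.
  have /forallP/(_ [` r0]%fset)/implyP/(_ (eqxx _)) := h (root_vertex in_root_ball).
  by rewrite ffunE => /eqP.
apply/forallP => y; apply/implyP => /eqP xy; rewrite ffunE -sa.
apply/eqP; congr (s _); apply: val_inj => /=.
by have := fsvalP y; rewrite -[fsval y]xy inE => /eqP.
Qed.

Lemma boundary_law_root (c a : spin q) :
  boundary_law lambda beta (const_boundary c) (root_config a) =
  root_partition c a / \sum_b root_partition c b.
Proof.
rewrite /boundary_law /gibbs_cond /gibbs_prob /gibbs -!mulr_suml.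
set ZB := partition_function _ _ _ _.
have ZB0 : ZB != 0.
  apply: lt0r_neq0; rewrite /ZB /partition_function.
  rewrite (bigD1 [ffun=> a]) //=.
  by apply: ltr_pwDl; rewrite ?expR_gt0 //; apply: sumr_ge0 => s _; apply: expR_ge0.
rewrite invf_div mulrA divfK //; congr (_ / _).
  rewrite /root_partition -(sum_boundary_ok lambda beta c in_root_ball).
  by apply: eq_bigl => s; rewrite /= restricts_root_config restricts_const_boundary.
rewrite (partition_big
  (fun s : {ffun B -> spin q} => s (root_vertex in_root_ball)) xpredT) //.
apply: eq_bigr => b _; rewrite /root_partition -(sum_boundary_ok lambda beta c in_root_ball).
by apply: eq_bigl => s; rewrite /= restricts_const_boundary andbC.
Qed.

End RootLaw.

Section Discrepancy.
Variables (R : realType) (q : nat) (lambda beta : R) (H : lfgraph).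
Variables (A : {fset H}) (n : nat).

Lemma dTV_ge0 (X : finType) (mu nu : X -> R) : 0 <= dTV mu nu.
Proof. by rewrite mulr_ge0 ?invr_ge0 //; apply: sumr_ge0. Qed.

Lemma dTV_ge_point (X : finType) (mu nu : X -> R) x :
  2^-1 * (mu x - nu x) <= dTV mu nu.
Proof.
rewrite /dTV ler_pM2l ?invr_gt0 // (bigD1 x) //=.
by rewrite (le_trans (ler_norm _)) // lerDl; apply: sumr_ge0.
Qed.

(** There are finitely many boundary conditions, so the supremum is over a
    bounded set. *)
Lemma dTV_le_max_discrepancy (b1 b2 : {ffun sphere_to A n -> spin q}) :
  dTV (boundary_law lambda beta b1) (boundary_law lambda beta b2) <=
  max_discrepancy q lambda beta A n.
Proof.
apply: ub_le_sup; last by exists b1, b2.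
exists (\sum_(b : {ffun sphere_to A n -> spin q} * {ffun sphere_to A n -> spin q})
  dTV (boundary_law lambda beta b.1) (boundary_law lambda beta b.2)).
move=> _ [c1 [c2 ->]]; rewrite (bigD1 (c1, c2)) //= lerDl.
by apply: sumr_ge0 => b _; apply: dTV_ge0.
Qed.

End Discrepancy.

(** Under the boundary colour 1 the root has that colour with probability at
    least 1/2, and under the boundary colour 2 with probability at most
    1/4. *)
Lemma max_discrepancy_root (R : realType) (q : nat) (lambda beta eps : R) (m : nat) :
  (2 < q)%N -> 0 <= lambda -> 0 <= beta -> 0 < eps ->
  q.+1%:R ^+ (q.-1).*2 * expR lambda ^+ q * eps <= 1 ->
  expR (- beta) <= eps ^+ 2 ->
  8^-1 <= max_discrepancy q lambda beta (root_set q) m.*2.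
Proof.
move=> q2 l0 b0 eps0 Keps beps.
have q1pow : q.+1%:R * eps <= 1.
  apply: le_trans Keps; rewrite ler_pM2r //.
  apply: (@le_trans _ _ (q.+1%:R ^+ (q.-1).*2)).
    rewrite -[leLHS]expr1; apply: ler_weXn2l; first by rewrite ler1n.
    by rewrite -addnn; lia.
  by rewrite ler_peMr ?exprn_ge0 // exprn_ege1 // -expR0 ler_expR.
have qeps : eps <= 4^-1 /\ q%:R * eps <= 1.
  have : 4 <= q.+1%:R :> R by rewrite ler_nat.
  rewrite -natr1 in q1pow *; nra.
case: qeps => eps4 qeps.
pose z (c a : spin q) := root_partition lambda beta m c a.
have z0 (c a : spin q) : 0 <= z c a by apply: subtree_sum_ge0.
have zc (c : spin q) : 0 < z c c by apply: subtree_sum_ground_gt0.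
have zr (c a : spin q) : (c < 2)%N -> a != c -> z c a <= eps * z c c.
  move=> c2 ac; apply: (subtree_sum_ratio (memB := @in_root_ball q m)
    q2 c2 l0 b0 eps0 _ Keps beps (k := m)).
  - by apply: le_trans eps4 _; lra.
  - by rewrite add0n.
  - by rewrite ffunE.
pose c0 : spin q := ord0; pose c1 : spin q := inord 1.
have c12 : (c1 < 2)%N by rewrite inordK //; lia.
have c01 : c0 != c1 by rewrite -(inj_eq val_inj) /= inordK //; lia.
have tot c : 0 < \sum_b z c b.
  by rewrite (bigD1 c) //=; apply: ltr_pwDl => //; apply: sumr_ge0.
apply: le_trans (dTV_le_max_discrepancy lambda beta
  (const_boundary m c0) (const_boundary m c1)).
apply: le_trans (dTV_ge_point _ _ (root_config c0)).
rewrite !boundary_law_root -/(z _ _).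
have h0 : 2^-1 <= z c0 c0 / \sum_b z c0 b.
  rewrite ler_pdivlMr // (bigD1 c0) //=.
  have : \sum_(b | b != c0) z c0 b <= \sum_(b : spin q | b != c0) eps * z c0 c0.
    by apply: ler_sum => b bc; apply: zr.
  rewrite sumr_const cardC1 card_ord -[X in _ <= X]mulr_natl mulrA.
  move=> h; have := ler_wpM2r (ltW (zc c0)) qeps; rewrite mul1r => h'.
  by have := zc c0; lra.
have h1 : z c1 c0 / (\sum_b z c1 b) <= 4^-1.
  rewrite ler_pdivrMr // (bigD1 c1) //=.
  have hs : 0 <= \sum_(b | b != c1) z c1 b by apply: sumr_ge0.
  have := zr c1 c0 c12 c01; have := ler_wpM2r (ltW (zc c1)) eps4; lra.
by move: h0 h1; rewrite /z; lra.
Qed.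

Theorem theorem2 (R : realType) (q : nat) (lambda : R)
  (hq : (3 <= q)%N) (hlambda : 0 < lambda) :
  exists beta0 : R, 0 < beta0 /\
    forall beta : R, beta0 <= beta ->
      ~ uniqueness q lambda beta (Ggraph q).
Proof.
pose K : R := q.+1%:R ^+ (q.-1).*2 * expR lambda ^+ q.
have K1 : 1 < K.
  have E1 : 1 <= expR lambda ^+ q.
    by rewrite exprn_ege1 // -expR0 ler_expR ltW.
  apply: (@lt_le_trans _ _ (q.+1%:R ^+ (q.-1).*2)).
    by rewrite exprn_egt1 ?ltr1n //; lia.
  by rewrite ler_peMr ?exprn_ge0.
have K0 : 0 < K by apply: lt_trans K1.
(* beta >= 2 ln K means exp (- beta) <= eps^2 for eps = 1/K *)
exists (2 * ln K); split; first by rewrite mulr_gt0 ?ln_gt0.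
move=> beta hbeta /(_ (root_set q)) /cvgrPdist_lt /(_ 8^-1).
case; first by rewrite invr_gt0.
move=> N _ /(_ N.*2) /=; rewrite sub0r normrN => h.
have {h} : `|max_discrepancy q lambda beta (root_set q) N.*2| < 8^-1.
  by apply: h; rewrite -addnn leq_addl.
apply/negP; rewrite -leNgt; apply: le_trans (ler_norm _).
apply: (max_discrepancy_root (eps := K^-1)) => //.
- exact: ltW.
- by apply: le_trans hbeta; rewrite mulr_ge0 // ln_ge0 // ltW.
- by rewrite invr_gt0.
- by rewrite -/K mulfV // gt_eqF.
rewrite exprVn expRN lef_pV2 ?posrE ?expR_gt0 ?exprn_gt0 //.
by rewrite -[K in K ^+ 2]lnK // expr2 -expRD ler_expR -mulr2n -mulr_natl.
Qed.
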